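(* In the second-best equilibrium, the number of SAV commuters and the corresponding fare are $$N_a^{SB*}=\frac{AN(1+\eta)-B}{2A},\qquad p^{SB*}=m+\frac{(1-\eta)AN-B}{2},$$ where $\eta=\frac{1-\kappa}{1-\theta}$. If this value of $N_a^{SB*}$ is below $0$ or above $N$, the number of SAV commuters is given by the corresponding boundary value, $0$ or $N$.
   Context: A continuum of commuters of mass $N>0$ splits between normal vehicles (NV, mass $N_n$) and shared autonomous vehicles (SAV, mass $N_a$), $N_n+N_a=N$, all passing a bottleneck of capacity $\mu>0$. Parameters: free-flow time $t_f\ge 0$; NV fixed cost $F_n\ge 0$; SAV waiting cost $w\ge 0$; SAV marginal operating cost $m\ge 0$; SAV fixed operating cost $F_a>0$; $\beta,\gamma>0$; $\theta$ with $\beta<\theta<1$; $0<\kappa<1$. Given the split and the SAV fare $p$, the mode-specific commuting costs (in departure-time equilibrium) are $$c_n^*(N_n,N_a)=\frac{\beta\gamma}{\mu(\beta+\gamma)}(N_n+\kappa N_a)+t_f+F_n,\qquad c_a^*(N_n,N_a)=\frac{\beta\gamma}{\mu(\beta+\gamma)}(\theta N_n+\kappa N_a)+\theta t_f+p+w ,$$ and the provider's profit is $\pi=(p-m)N_a-F_a$. Set $A=\frac{\beta\gamma(1-\theta)}{(\beta+\gamma)\mu}$, $B=\theta t_f+m+w-(t_f+F_n)$. Standing assumption: $0<B<AN$. Second-best equilibrium: the number of SAV commuters $N_a^{SB*}$ is the minimizer over $0\le N_a\le N$ (with $N_n=N-N_a$) of the social cost $$SC^{SB}(N_a)=N_nc_n^*(N_n,N_a)+N_ac_a^*(N_n,N_a)-\pi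 ,$$ and the second-best fare is $p^{SB*}=p(N_a^{SB*})$, where $p(N_a)=m+AN-B-AN_a$ is the inverse demand function, i.e. the fare for which $c_n^*=c_a^*$ at the split $(N-N_a,N_a)$. (The fare terms cancel in $SC^{SB}$.) *)

(* Defs.v *)
From HB Require Import structures.
From mathcomp Require Import all_boot all_order all_algebra.
From mathcomp Require Import ring.

Set Implicit Arguments.
Unset Strict Implicit.
Unset Printing Implicit Defensive.

Import Order.TTheory GRing.Theory Num.Theory.
Local Open Scope ring_scope.

Record params (R : realFieldType) : Type := Params {
  mass : R;         (* N *)
  capacity : R;     (* mu *)
  free_flow : R;    (* t_f *)
  nv_fixed : R;     (* F_n *)
  sav_waiting : R;  (* w *)
  sav_marginal : R; (* m *)
  sav_fixed : R;    (* F_a *)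
  beta : R;
  gamma : R;
  theta : R;
  kappa : R
}.

Section Model.
Variables (R : realFieldType) (P : params R).

Local Notation N := (mass P).
Local Notation mu := (capacity P).
Local Notation t_f := (free_flow P).
Local Notation F_n := (nv_fixed P).
Local Notation w := (sav_waiting P).
Local Notation m := (sav_marginal P).
Local Notation F_a := (sav_fixed P).
Local Notation beta := (beta P).
Local Notation gamma := (gamma P).
Local Notation theta := (theta P).
Local Notation kappa := (kappa P).

Definition nv_cost (Nn Na : R) : R :=
  beta * gamma / (mu * (beta + gamma)) * (Nn + kappa * Na) + t_f + F_n.

Definition sav_cost (p Nn Na : R) : R :=
  beta * gamma / (mu * (beta + gamma)) * (theta * Nn + kappa * Na)
  + theta * t_f + p + w.

Definition profit (p Na : R) : R := (p - m) * Na - F_a.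

Definition demandA : R := beta * gamma * (1 - theta) / ((beta + gamma) * mu).

Definition demandB : R := theta * t_f + m + w - (t_f + F_n).

Definition eta_ratio : R := (1 - kappa) / (1 - theta).

Record standing : Prop := Standing {
  mass_gt0 : 0 < N;
  capacity_gt0 : 0 < mu;
  free_flow_ge0 : 0 <= t_f;
  nv_fixed_ge0 : 0 <= F_n;
  sav_waiting_ge0 : 0 <= w;
  sav_marginal_ge0 : 0 <= m;
  sav_fixed_gt0 : 0 < F_a;
  beta_gt0 : 0 < beta;
  gamma_gt0 : 0 < gamma;
  theta_bounds : beta < theta < 1;
  kappa_bounds : 0 < kappa < 1;
  demandB_bounds : 0 < demandB < demandA * N
}.

Definition inverse_demand (Na : R) : R := m + demandA * N - demandB - demandA * Na.

Lemma inverse_demandP (p Na : R) :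
  nv_cost (N - Na) Na = sav_cost p (N - Na) Na <-> p = inverse_demand Na.
Proof.
rewrite /nv_cost /sav_cost /inverse_demand /demandA /demandB.
rewrite [(beta + gamma) * mu]mulrC.
set k := (mu * (beta + gamma))^-1; split=> h; last by rewrite h; ring.
have -> : p = p + (beta * gamma * k * (N - Na + kappa * Na) + t_f + F_n)
    - (beta * gamma * k * (theta * (N - Na) + kappa * Na) + theta * t_f + p + w).
  by rewrite h addrK.
ring.
Qed.

Definition social_cost (p Na : R) : R :=
  (N - Na) * nv_cost (N - Na) Na + Na * sav_cost p (N - Na) Na - profit p Na.

Lemma social_cost_fare (p q Na : R) : social_cost p Na = social_cost q Na.
Proof. by rewrite /social_cost /sav_cost /profit; ring. Qed.

(* The fare is immaterial here, by [social_cost_fare]. *)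
Definition second_best_cost (Na : R) : R := social_cost (inverse_demand Na) Na.

Definition second_best_number (Na : R) : Prop :=
  0 <= Na <= N /\
  forall x : R, 0 <= x <= N -> second_best_cost Na <= second_best_cost x.

Definition second_best_equilibrium (Na p : R) : Prop :=
  second_best_number Na /\ p = inverse_demand Na.

End Model.

(* Main.v *)
Require Import Defs.
From HB Require Import structures.
From mathcomp Require Import all_boot all_order all_algebra.
From mathcomp Require Import ring lra.
Set Implicit Arguments.
Unset Strict Implicit.
Unset Printing Implicit Defensive.
Import Order.TTheory GRing.Theory Num.Theory.
Local Open Scope ring_scope.

(** Under [N_n = N - N_a] the fare cancels and the social cost is a quadratic
polynomial in [N_a] with leading coefficient [A > 0] and vertex
[v = (A N (1 + eta) - B) / (2 A)]; this is [second_best_costB].  Hence, for a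
point [u] of [[0, N]],
[SC(x) - SC(u) = A ((x - u)^2 + 2 (x - u) (u - v))],
so that [u] is the unique minimizer as soon as it satisfies the variational
inequality [(x - u) (u - v) >= 0] for all feasible [x]
([second_best_number_unique]).  This inequality holds for [u = v] when [v] is
feasible, for [u = 0] when [v < 0] and for [u = N] when [N < v].  The fare
then comes from evaluating the inverse demand at [v]. *)

Lemma demandA_gt0 (R : realFieldType) (P : params R) :
  standing P -> 0 < demandA P.
Proof.
move=> hP; have /andP[_ theta_lt1] := theta_bounds hP.
have mu_gt0 := capacity_gt0 hP.
have beta_gt0 := beta_gt0 hP; have gamma_gt0 := gamma_gt0 hP.
by rewrite /demandA divr_gt0 ?mulr_gt0 ?subr_gt0 ?addr_gt0.
Qed.

(** The unconstrained minimizer of the social cost, that is the vertex of the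
parabola. *)
Definition second_best_vertex (R : realFieldType) (P : params R) : R :=
  (demandA P * mass P * (1 + eta_ratio P) - demandB P) / (2 * demandA P).

Lemma second_best_vertexE (R : realFieldType) (P : params R) :
  standing P ->
  2 * demandA P * second_best_vertex P =
  demandA P * mass P * (1 + eta_ratio P) - demandB P.
Proof.
move=> hP; have A_gt0 := demandA_gt0 hP.
by rewrite /second_best_vertex mulrC divfK // mulf_neq0 ?pnatr_eq0 ?gt_eqF.
Qed.

(** Increments of the social cost, expanded about [u]; the
linear coefficient is the slope [2 A (u - v)] at [u]. *)
Lemma second_best_costB (R : realFieldType) (P : params R) (x u : R) :
  standing P ->
  second_best_cost P x - second_best_cost P u =
  demandA P * ((x - u) ^+ 2 + 2 * ((x - u) * (u - second_best_vertex P))).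
Proof.
move=> hP; have /andP[_ theta_lt1] := theta_bounds hP.
have theta_neq1 : 1 - theta P != 0 by rewrite subr_eq0 gt_eqF.
have vE := second_best_vertexE hP.
(* With [c = beta gamma / (mu (beta + gamma))], [A = c (1 - theta)], so that
   [A eta = c (1 - kappa)], the fall in congestion cost when one SAV replaces
   one NV. *)
have AetaE : demandA P * eta_ratio P =
    beta P * gamma P / (capacity P * (beta P + gamma P)) * (1 - kappa P).
  rewrite /demandA /eta_ratio [(beta P + gamma P) * _]mulrC.
  by set k := (capacity P * _)^-1; field.
transitivity (demandA P * (x ^+ 2 - u ^+ 2)
    - (x - u) * (2 * demandA P * second_best_vertex P)); last by ring.
rewrite vE [_ * (1 + _)]mulrDr mulr1 [_ * eta_ratio P]mulrAC AetaE.
rewrite /second_best_cost /social_cost /nv_cost /sav_cost /profit.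
rewrite /demandB /demandA [(beta P + gamma P) * _]mulrC.
by set k := (capacity P * _)^-1; ring.
Qed.

Lemma second_best_number_unique (R : realFieldType) (P : params R) (u : R) :
  standing P -> 0 <= u <= mass P ->
  (forall x, 0 <= x <= mass P -> 0 <= (x - u) * (u - second_best_vertex P)) ->
  forall Na, second_best_number P Na <-> Na = u.
Proof.
move=> hP u_in u_var Na; have A_gt0 := demandA_gt0 hP; split=> [|->].
  move=> [Na_in /(_ u u_in)]; rewrite -subr_le0 second_best_costB //.
  rewrite pmulr_rle0 // => sq_le0.
  apply/eqP; rewrite -subr_eq0 -sqrf_eq0 eq_le sqr_ge0 andbT.
  by have := u_var _ Na_in; lra.
split=> // x x_in; rewrite -subr_ge0 second_best_costB //.
by rewrite mulr_ge0 ?(ltW A_gt0) // addr_ge0 ?sqr_ge0 // mulr_ge0 ?u_var.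
Qed.

Lemma inverse_demand_vertex (R : realFieldType) (P : params R) :
  standing P ->
  inverse_demand P (second_best_vertex P) =
  sav_marginal P + ((1 - eta_ratio P) * demandA P * mass P - demandB P) / 2.
Proof.
move=> hP; have vE := second_best_vertexE hP.
rewrite /inverse_demand.
have -> : demandA P * second_best_vertex P =
    (demandA P * mass P * (1 + eta_ratio P) - demandB P) / 2.
  by rewrite -vE; field.
by field.
Qed.

Theorem proposition7 (R : realFieldType) (P : params R) (hP : standing P) :
  let N := mass P in
  let m := sav_marginal P in
  let A := demandA P in
  let B := demandB P in
  let NaSB := (A * N * (1 + eta_ratio P) - B) / (2 * A) in
  [/\ 0 <= NaSB <= N ->
        forall Na p : R, second_best_equilibrium P Na p <->
          Na = NaSB /\ p = m + ((1 - eta_ratio P) * A * N - B) / 2,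
      NaSB < 0 -> forall Na : R, second_best_number P Na <-> Na = 0
    & N < NaSB -> forall Na : R, second_best_number P Na <-> Na = N].
Proof.
move=> N m A B NaSB; have N_ge0 : 0 <= N := ltW (mass_gt0 hP).
rewrite -[NaSB]/(second_best_vertex P); split=> [v_in Na p | v_lt0 | v_gtN].
- have minP : second_best_number P Na <-> Na = second_best_vertex P.
    by apply: second_best_number_unique => // x _; rewrite subrr mulr0.
  rewrite -inverse_demand_vertex //.
  split=> [[/minP -> ->] // | [NaE ->]].
  by split; [exact/minP | rewrite NaE].
- apply: second_best_number_unique => //; first by rewrite lexx.
  move=> x /andP[x_ge0 _].
  by rewrite mulr_ge0 ?subr_ge0 // ltW.
apply: second_best_number_unique => //; first by rewrite lexx andbT.
move=> x /andP[_ x_leN].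
by rewrite mulr_le0 ?subr_le0 // ltW.
Qed.
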